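(* Let $A\in\mathbb{R}^{Nn\times Nn}$ be a symmetric block tridiagonal matrix with diagonal blocks $b_k\in\mathbb{R}^{n\times n}$ ($k=1,\dots,N$), blocks $c_k\in\mathbb{R}^{n\times n}$ in block position $(k,k-1)$ and $c_k^{\mathrm T}$ in block position $(k-1,k)$ ($k=2,\dots,N$), and all other blocks zero. Suppose $\alpha_L,\alpha_U$ are real numbers with $$0<\alpha_L\le\lambda_{\min}(A)\le\lambda_{\max}(A)\le\alpha_U.$$ Let $d_1^f=b_1$ and $d_k^f=b_k-c_k(d_{k-1}^f)^{-1}c_k^{\mathrm T}$ for $k=2,\dots,N$, and let $d_N^b=b_N$ and $d_k^b=b_k-c_{k+1}^{\mathrm T}(d_{k+1}^b)^{-1}c_{k+1}$ for $k=N-1,\dots,1$. Then $$0<\alpha_L\le\lambda_{\min}(d_k^f+d_k^b-b_k)\le\lambda_{\max}(d_k^f+d_k^b-b_k)\le\alpha_U\qquad\text{for all }k=1,\dots,N.$$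
   Context: $\lambda_{\min},\lambda_{\max}$ denote the minimum and maximum eigenvalues of a symmetric matrix. *)

(* Defs.v *)
From HB Require Import structures.
From mathcomp Require Import all_boot all_order all_algebra.
From mathcomp Require Import all_classical all_reals.

Set Implicit Arguments.
Unset Strict Implicit.
Unset Printing Implicit Defensive.

Import Order.TTheory GRing.Theory Num.Theory.
Local Open Scope classical_set_scope.
Local Open Scope ring_scope.

(* The set of eigenvalues is finite, so inf and sup are the minimum and the
   maximum as soon as a real eigenvalue exists, as it does for a symmetric
   matrix of positive size (on the empty set, inf and sup are 0). *)
Definition lambda_min (R : realType) (m : nat) (M : 'M[R]_m) : R :=
  inf [set a : R | eigenvalue M a].

Definition lambda_max (R : realType) (m : nat) (M : 'M[R]_m) : R :=
  sup [set a : R | eigenvalue M a].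

(* Blocks are numbered from 1: row i : 'I_N of the block matrix is block row
   i.+1. Only b 1, ..., b N and c 2, ..., c N are used. The dimension
   \sum_(k < N) n is N * n. *)
Definition block_tridiag (R : realType) (N n : nat) (b c : nat -> 'M[R]_n) :
    'M[R]_(\sum_(k < N) n) :=
  \mxblock_(i < N, j < N)
    (if i == j then b i.+1
     else if i == j.+1 :> nat then c i.+1
     else if j == i.+1 :> nat then (c j.+1)^T
     else 0).

(* Main.v *)
Require Import Defs.
From HB Require Import structures.
From mathcomp Require Import all_boot all_order all_algebra.
From mathcomp Require Import all_classical all_reals.
From mathcomp Require Import spectral sesquilinear complex ring zify.

Set Implicit Arguments.
Unset Strict Implicit.
Unset Printing Implicit Defensive.

Import Order.TTheory GRing.Theory Num.Theory.
Local Open Scope ring_scope.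

(** The matrix S = d_k^f + d_k^b - b_k is the Schur complement of A onto its
    k-th diagonal block, and everything is read off the quadratic form of A.

    Fix a vector v in block k and extend it to the left by
    x_(i-1) = - (d_(i-1)^f)^-1 c_i^T x_i and to the right symmetrically. This
    eliminates the other blocks, and completing squares one block at a time
    shows that x^T A x = v^T S v. Hence

      v^T S v = x^T A x >= alpha_L |x|^2 >= alpha_L |v|^2,

    as v is one of the blocks of x. The same extension, to the left only and
    with zeros to the right of k, gives v^T d_k^f v >= alpha_L |v|^2 (lemma
    [pivot_ge]). This is proved along the recursion, so each pivot is
    invertible by the time its inverse is needed. Since the pivots are positive
    definite, the corrections subtracted from b_k are positive semidefinite:
    d_k^f <= b_k and d_k^b <= b_k ([pivot_le]). Therefore S <= b_k, and b_k is
    a diagonal block of A, so that v^T S v <= v^T b_k v <= alpha_U |v|^2. The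
    two bounds are [twisted_pivot_bounds].

    The backward recursion is the forward recursion of the matrix whose blocks
    are listed in the opposite order, so only the forward one is analysed;
    [energy_split] glues the two at block k.

    The passage between eigenvalues and quadratic forms, in both directions
    ([lambda_min_max_bounds] for A, [bform_bounds_lambda] for S), rests on the
    spectral theorem, taken from the complex numbers over R. In the lemmas the
    vectors are rows, x A x^T instead of x^T A x, in accordance with the
    convention for eigenvectors. *)

(** * Quadratic forms and eigenvalues of real symmetric matrices *)

Section QuadraticForms.
Variable R : realType.

Definition bform n (M : 'M[R]_n) (u v : 'rV[R]_n) : R :=
  (u *m M *m v^T) 0 0.

Definition sqnorm n (u : 'rV[R]_n) : R := (u *m u^T) 0 0.

Lemma bformDm n (M M' : 'M[R]_n) u v :
  bform (M + M') u v = bform M u v + bform M' u v.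
Proof. by rewrite /bform mulmxDr mulmxDl mxE. Qed.

Lemma bformBm n (M M' : 'M[R]_n) u v :
  bform (M - M') u v = bform M u v - bform M' u v.
Proof. by rewrite /bform mulmxBr mulmxBl !mxE. Qed.

Lemma bform_tr n (M : 'M[R]_n) u v : bform M^T u v = bform M v u.
Proof.
have -> : bform M v u = (v *m M *m u^T)^T 0 0 by rewrite mxE.
by rewrite !trmx_mul trmxK mulmxA.
Qed.

Lemma bform0l n (M : 'M[R]_n) v : bform M 0 v = 0.
Proof. by rewrite /bform !mul0mx mxE. Qed.

Lemma bform0r n (M : 'M[R]_n) v : bform M v 0 = 0.
Proof. by rewrite -bform_tr bform0l. Qed.

Lemma sqnormE n (u : 'rV[R]_n) : sqnorm u = \sum_i u 0 i ^+ 2.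
Proof. by rewrite /sqnorm mxE; apply: eq_bigr => i _; rewrite mxE expr2. Qed.

Lemma sqnorm_ge0 n (u : 'rV[R]_n) : 0 <= sqnorm u.
Proof. by rewrite sqnormE sumr_ge0 // => i _; rewrite sqr_ge0. Qed.

Lemma sqnorm_eq0 n (u : 'rV[R]_n) : (sqnorm u == 0) = (u == 0).
Proof.
apply/idP/eqP => [|->]; last by rewrite /sqnorm mul0mx mxE.
rewrite sqnormE psumr_eq0 => [/allP u0|i _]; last exact: sqr_ge0.
apply/rowP => i; rewrite mxE; apply/eqP; rewrite -sqrf_eq0.
exact/u0/mem_index_enum.
Qed.

Lemma sqnorm_gt0 n (u : 'rV[R]_n) : (0 < sqnorm u) = (u != 0).
Proof. by rewrite lt_def sqnorm_ge0 andbT sqnorm_eq0. Qed.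

Lemma bform_eigenvalue n (M : 'M[R]_n) a : eigenvalue M a ->
  exists2 v : 'rV_n, 0 < sqnorm v & bform M v v = a * sqnorm v.
Proof.
case/eigenvalueP => v vM v0; exists v; first by rewrite sqnorm_gt0.
by rewrite /bform vM -scalemxAl mxE.
Qed.

Lemma coercive_unitmx n (M : 'M[R]_n) a : 0 < a ->
  (forall v, a * sqnorm v <= bform M v v) -> M \in unitmx.
Proof.
move=> a0 H; rewrite -row_free_unit -kermx_eq0; apply/negbNE/negP.
case/rowV0Pn => v /sub_kermxP vM v0; have := H v.
by rewrite /bform vM mul0mx mxE leNgt pmulr_rgt0 // sqnorm_gt0 v0.
Qed.

Local Open Scope sesquilinear_scope.
Local Notation f := (real_complex R).

(** A real symmetric matrix is Hermitian over R[i], where it is diagonalised by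
    a unitary matrix P, with real eigenvalues. The weights w are the squared
    moduli of the coordinates of x in the basis of the rows of P; keeping only
    these makes the conclusion free of complex numbers. *)
Lemma symmetric_spectral n (M : 'M[R]_n) : M^T = M ->
  exists2 d : 'I_n -> R, (forall i, eigenvalue M (d i)) &
  forall x : 'rV_n, exists w : 'I_n -> R, [/\ forall i, 0 <= w i,
    sqnorm x = \sum_i w i & bform M x x = \sum_i w i * d i].
Proof.
move=> Msym; pose Mc := map_mx f M.
have realf m p (X : 'M[R]_(m, p)) : map_mx f X \is a realmx.
  apply/mxOverP => i j; rewrite mxE; apply/complex_realP; by eexists.
have trCf m p (X : 'M[R]_(m, p)) : (map_mx f X)^t* = (map_mx f X)^T.
  by rewrite [_^T]map_trmx; exact/realmxC/realf.
have Mh : Mc \is hermsymmx.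
  apply: realsym_hermsym; last exact: realf.
  apply/is_hermitianmxP; rewrite expr0 scale1r map_mx_id //.
  by rewrite map_trmx Msym.
have /orthomx_spectralP Meq := hermitian_normalmx Mh.
have Dreal := hermitian_spectral_diag_real Mh.
move: (spectral_unitarymx Mc) Meq Dreal.
move: (spectralmx Mc) (spectral_diag Mc) => P D Pu Meq Dreal.
have Punit := unitarymx_unit Pu.
pose d i := complex.Re (D 0 i).
have dE i : f (d i) = D 0 i.
  by apply: RRe_real; move/mxOverP: Dreal; apply.
exists d => [i|x].
  have : eigenvalue Mc (D 0 i).
    apply/eigenvalueP; exists (row i P).
      rewrite -row_mul Meq !mulmxA mulmxV // mul1mx row_mul row_diag_mx.
      by rewrite -scalemxAl -rowE.
    rewrite rowE mulmx_free_eq0 ?row_free_unit //.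
    apply/eqP => /rowP /(_ i) /eqP; rewrite !mxE !eqxx.
    by rewrite oner_eq0.
  by rewrite -dE eigenvalue_map.
(* The coordinates of x in the eigenbasis. *)
pose y := map_mx f x *m P^t*.
have yE : y^t* = P *m (map_mx f x)^T.
  rewrite /y trmx_mul map_mxM /= trmxCK; congr (_ *m _).
  by rewrite trCf.
have [w w0 wE] : exists2 w : 'I_n -> R, forall i, 0 <= w i &
    forall i, f (w i) = y 0 i * (y 0 i)^*.
  have wE i : f (complex.Re (`|y 0 i| ^+ 2)) = y 0 i * (y 0 i)^*.
    by rewrite -normCK; apply: RRe_real; rewrite rpredX ?normr_real.
  exists (fun i => complex.Re (`|y 0 i| ^+ 2)) => // i.
  by rewrite -ler0c -[leRHS]/(f _) wE -normCK exprn_ge0.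
exists w; split=> //.
- apply: (@complexI R); rewrite -[LHS]/(f _) -[RHS]/(f _) rmorph_sum.
  have -> : f (sqnorm x) = (y *m y^t*) 0 0.
    rewrite yE /y -(invmx_unitary Pu) mulmxA mulmxKV //.
    by rewrite map_trmx -map_mxM mxE.
  by rewrite mxE; apply: eq_bigr => i _; rewrite [RHS]/= wE; congr (_ * _);
     rewrite !mxE.
- apply: (@complexI R); rewrite -[LHS]/(f _) -[RHS]/(f _) rmorph_sum.
  have -> : f (bform M x x) = (y *m diag_mx D *m y^t*) 0 0.
    rewrite yE /y -(invmx_unitary Pu) !mulmxA.
    rewrite -[_ *m _ *m diag_mx D *m P]mulmxA -[_ *m _ *m (_ *m P)]mulmxA.
    by rewrite [invmx P *m _]mulmxA -Meq map_trmx -!map_mxM mxE.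
  rewrite mul_mx_diag mxE; apply: eq_bigr => i _; rewrite rmorphM.
  apply: etrans (esym (congr2 *%R (wE i) (dE i))); rewrite [RHS]mulrAC.
  by congr (_ * _); rewrite !mxE.
Qed.

Lemma eigenvalue_bounds n (M : 'M[R]_n) l u : M^T = M ->
  (forall a, eigenvalue M a -> l <= a <= u) ->
  forall x, l * sqnorm x <= bform M x x <= u * sqnorm x.
Proof.
move=> Ms lu x; have [d dM /(_ x) [w [w0 -> ->]]] := symmetric_spectral Ms.
rewrite !mulr_sumr; apply/andP; split; apply: ler_sum => i _;
  by have /andP[ld du] := lu _ (dM i); rewrite [_ * w i]mulrC ler_wpM2l.
Qed.

Lemma bform_bounds_eigenvalue n (M : 'M[R]_n) l u :
  (forall x, l * sqnorm x <= bform M x x <= u * sqnorm x) ->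
  forall a, eigenvalue M a -> l <= a <= u.
Proof.
move=> lu a /bform_eigenvalue [v v0 va]; have := lu v.
by rewrite va !ler_pM2r.
Qed.

(** Without this bound the infimum and the supremum of the spectrum would carry
    no information. *)
Lemma symmetric_eigenvalue_bounded n (M : 'M[R]_n) : M^T = M ->
  exists t, forall a, eigenvalue M a -> - t <= a <= t.
Proof.
move=> Ms; have [d dM H] := symmetric_spectral Ms.
exists (\sum_i `|d i|); apply: bform_bounds_eigenvalue => x.
have [w [w0 -> ->]] := H x.
have dle i : `|d i| <= \sum_j `|d j|.
  by rewrite (bigD1 i) //= lerDl sumr_ge0.
by rewrite !mulr_sumr; apply/andP; split; apply: ler_sum => i _;
  have := dle i; rewrite ler_norml => /andP[ld du]; rewrite [_ * w i]mulrC ler_wpM2l.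
Qed.

Lemma symmetric_eigenvalue_exists n (M : 'M[R]_n) : (0 < n)%N -> M^T = M ->
  exists a, eigenvalue M a.
Proof.
by case: n M => // n M _ /symmetric_spectral [d dM _]; exists (d 0).
Qed.

Lemma lambda_min_max_bounds n (M : 'M[R]_n) : M^T = M ->
  forall x, lambda_min M * sqnorm x <= bform M x x <= lambda_max M * sqnorm x.
Proof.
move=> Ms; have [t Mt] := symmetric_eigenvalue_bounded Ms.
apply: eigenvalue_bounds => // a Ma; apply/andP; split.
  by apply: ge_inf => //; exists (- t) => b /Mt /andP[].
by apply: ub_le_sup => //; exists t => b /Mt /andP[].
Qed.

Lemma bform_bounds_lambda n (M : 'M[R]_n) l u : (0 < n)%N -> M^T = M ->
  (forall x, l * sqnorm x <= bform M x x <= u * sqnorm x) ->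
  [/\ l <= lambda_min M, lambda_min M <= lambda_max M & lambda_max M <= u].
Proof.
move=> n0 Ms /bform_bounds_eigenvalue lu.
have [a Ma] := symmetric_eigenvalue_exists n0 Ms.
split.
- by apply: lb_le_inf; [exists a | move=> b /lu /andP[]].
- apply: (@le_trans _ _ a).
    by apply: ge_inf => //; exists l => b /lu /andP[].
  by apply: ub_le_sup => //; exists u => b /lu /andP[].
- by apply: ge_sup; [exists a | move=> b /lu /andP[]].
Qed.

End QuadraticForms.

(** * The quadratic form of a block tridiagonal matrix *)

Section Energy.
Variables (R : realType) (n : nat).
Implicit Types (B C D : nat -> 'M[R]_n) (x : nat -> 'rV[R]_n).

(** The value x^T A x for the block tridiagonal matrix A with diagonal blocks
    B 0, ..., B m and subdiagonal blocks C 1, ..., C m, where C i stands in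
    block position (i, i - 1). Blocks are numbered from 0, so that initial
    segments and reversals are easy to describe. *)
Definition energy B C m x : R :=
  \sum_(i < m.+1) bform (B i) (x i) (x i) +
  2 * \sum_(i < m) bform (C i.+1) (x i.+1) (x i).

Lemma energy0 B C x : energy B C 0 x = bform (B 0) (x 0) (x 0).
Proof. by rewrite /energy big_ord1 big_ord0 mulr0 addr0. Qed.

Lemma energyS B C m x : energy B C m.+1 x = energy B C m x +
  bform (B m.+1) (x m.+1) (x m.+1) + 2 * bform (C m.+1) (x m.+1) (x m).
Proof. by rewrite /energy big_ord_recr [X in 2 * X]big_ord_recr /=; ring. Qed.

Lemma eq_energy B C m x y : (forall i, (i <= m)%N -> x i = y i) ->
  energy B C m x = energy B C m y.
Proof.
elim: m => [|m IH] xy; first by rewrite !energy0 xy.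
by rewrite !energyS !xy // IH // => i im; apply: xy; lia.
Qed.

Lemma energy_supp_last B C m x : (forall i, (i < m)%N -> x i = 0) ->
  energy B C m x = bform (B m) (x m) (x m).
Proof.
case: m => [|m] x0; first by rewrite energy0.
have E0 : energy B C m x = 0.
  rewrite /energy !big1 ?mulr0 ?addr0 // => i _.
    by rewrite x0 ?bform0l // ltnS ltn_ord.
  by rewrite x0 ?bform0l.
by rewrite energyS E0 (x0 m) // bform0r mulr0 addr0 add0r.
Qed.

(** The blocks of the matrix read from the last block row to the first: the
    subdiagonal block i of the reversed matrix is the superdiagonal block of the
    original one in position (L - i, L - i + 1). *)
Definition rev_diag L B i := B (L - i)%N.
Definition rev_sub L C i := (C (L - i).+1)^T.

(** The couplings of a block tridiagonal matrix lie either in the blocks up to k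
    or in the blocks from k on, and only the diagonal term of block k is shared.
    For k = 0 this says that reversal preserves the energy. *)
Lemma energy_split B C L k x : (k <= L)%N ->
  energy B C L x = energy B C k x
    + energy (rev_diag L B) (rev_sub L C) (L - k) (fun i => x (L - i)%N)
    - bform (B k) (x k) (x k).
Proof.
move=> kL; rewrite -{1 3 4 5}(subKn kL); have := leq_subr k L.
elim: (L - k)%N => [|j IH] jL; first by rewrite subn0 energy0 /rev_diag subn0; ring.
rewrite energyS (IH (ltnW jL)) (_ : L - j = (L - j.+1).+1)%N; last by lia.
rewrite energyS /rev_diag /rev_sub bform_tr.
by ring.
Qed.

Definition tail_zero m x i := if (i <= m)%N then x i else 0.

Lemma energy_tail_zero B C L m x : (m <= L)%N ->
  energy B C L (tail_zero m x) = energy B C m x.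
Proof.
move=> mL; rewrite (energy_split _ _ _ mL) [X in _ + X - _]energy_supp_last; last first.
  by move=> i iL; rewrite /tail_zero ifF //; lia.
rewrite /rev_diag subKn // addrK; apply: eq_energy => i im.
by rewrite /tail_zero im.
Qed.

Definition coercive a B C L := forall x,
  a * \sum_(i < L.+1) sqnorm (x i) <= energy B C L x.

Lemma coercive_rev a B C L :
  coercive a B C L -> coercive a (rev_diag L B) (rev_sub L C) L.
Proof.
move=> H x; have := H (fun i => x (L - i)%N).
rewrite (energy_split _ _ _ (leq0n L)) energy0 addrAC subrr add0r subn0.
rewrite (@eq_energy _ _ L _ x) => [|i iL]; last by rewrite subKn.
apply: le_trans; rewrite le_eqVlt; apply/orP; left; apply/eqP; congr (_ * _).
rewrite (reindex_inj rev_ord_inj) /=; apply: eq_bigr => i _.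
by rewrite subSS.
Qed.

(** Keeping one block of x is the only estimate lost in the lower bound. *)
Lemma coercive_block a B C L k x : 0 <= a -> coercive a B C L -> (k <= L)%N ->
  a * sqnorm (x k) <= energy B C L x.
Proof.
move=> a0 H kL; apply: le_trans (H x); rewrite ler_wpM2l //.
rewrite (bigD1 (Ordinal (kL : (k < L.+1)%N))) //= lerDl.
by apply: sumr_ge0 => i _; exact: sqnorm_ge0.
Qed.

Lemma diag_block_le u B C L k v :
  (forall x, energy B C L x <= u * \sum_(i < L.+1) sqnorm (x i)) ->
  (k <= L)%N -> bform (B k) v v <= u * sqnorm v.
Proof.
move=> H kL; pose x i := if i == k then v else 0.
have xk : x k = v by rewrite /x eqxx.
have := H x; rewrite (@eq_energy _ _ _ x (tail_zero k x)) => [|i _]; last first.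
  by rewrite /tail_zero /x; case: eqP => [->|_]; rewrite ?leqnn // if_same.
rewrite energy_tail_zero // energy_supp_last ?xk => [|i ik]; last first.
  by rewrite /x ltn_eqF.
rewrite (bigD1 (Ordinal (kL : (k < L.+1)%N))) //= xk big1 ?addr0 // => i.
by rewrite /x -val_eqE /= => /negbTE ->; apply/eqP; rewrite sqnorm_eq0.
Qed.

(** Completing the square: u is the critical point of the quadratic polynomial
    u D u^T + 2 v C u^T, and the right-hand side is its critical value. *)
Lemma schur_energy (D C : 'M[R]_n) v : D^T = D -> D \in unitmx ->
  let u := - (v *m C *m invmx D) in
  bform D u u + 2 * bform C v u = - bform (C *m invmx D *m C^T) v v.
Proof.
move=> Ds Du u.
have uD : u *m D = - (v *m C) by rewrite /u mulNmx mulmxKV.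
have uT : u^T = - (invmx D *m C^T *m v^T).
  by rewrite /u [LHS]linearN /= !trmx_mul trmx_inv Ds mulmxA.
rewrite /bform uD uT !mulNmx !mulmxN !mulmxA !mxE; ring.
Qed.

Section Pivots.
Variables (a : R) (L : nat) (B C D : nat -> 'M[R]_n).
Hypotheses (a_gt0 : 0 < a) (Bs : forall i, (i <= L)%N -> (B i)^T = B i).
Hypothesis BC : coercive a B C L.
Hypothesis D0 : D 0 = B 0.
Hypothesis DS : forall i, (i < L)%N ->
  D i.+1 = B i.+1 - C i.+1 *m invmx (D i) *m (C i.+1)^T.

(** A vector on the blocks 0, ..., m is a vector on all the blocks with the same
    energy, by extension with zeros. This is how a lower bound on the whole
    matrix reaches the m-th pivot. *)
Lemma pivot_coercive m : (m <= L)%N ->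
  (forall v, exists2 x, x m = v & energy B C m x = bform (D m) v v) ->
  forall v, a * sqnorm v <= bform (D m) v v.
Proof.
move=> mL H v; have [x xv <-] := H v.
rewrite -(energy_tail_zero _ _ _ mL) -{1}xv.
have -> : x m = tail_zero m x m by rewrite /tail_zero leqnn.
exact: coercive_block (ltW a_gt0) BC mL.
Qed.

(** The m-th pivot is the value of the energy after elimination of the blocks
    before m. The vector is built by back substitution, and the step from m to
    m + 1 needs D m invertible: the induction hypothesis gives this through
    [pivot_coercive]. *)
Lemma pivot_energy m : (m <= L)%N -> (D m)^T = D m /\
  forall v, exists2 x, x m = v & energy B C m x = bform (D m) v v.
Proof.
elim: m => [_|m IH mL].
  by rewrite D0; split=> [|v]; [exact: Bs | exists (fun=> v); rewrite ?energy0].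
have [Ds H] := IH (ltnW mL).
have Du := coercive_unitmx a_gt0 (pivot_coercive (ltnW mL) H).
rewrite (DS mL); split=> [|v].
  by rewrite linearB /= !trmx_mul trmxK trmx_inv Ds Bs // mulmxA.
have [x xm xE] := H (- (v *m C m.+1 *m invmx (D m))).
exists (fun i => if (i <= m)%N then x i else v); first by rewrite ltnn.
rewrite energyS ltnn leqnn (@eq_energy _ _ _ _ x) => [|i ->] //.
rewrite xE xm bformBm -(schur_energy (C m.+1) v Ds Du); ring.
Qed.

Lemma pivot_ge m : (m <= L)%N -> forall v, a * sqnorm v <= bform (D m) v v.
Proof. by move=> mL; apply: pivot_coercive => //; case: (pivot_energy mL). Qed.

Lemma pivot_unitmx m : (m <= L)%N -> D m \in unitmx.
Proof. by move=> mL; exact: coercive_unitmx a_gt0 (pivot_ge mL). Qed.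

Lemma pivot_le m : (m <= L)%N -> forall v, bform (D m) v v <= bform (B m) v v.
Proof.
case: m => [_ v|m mL v]; first by rewrite D0.
have [Ds _] := pivot_energy (ltnW mL); have Du := pivot_unitmx (ltnW mL).
rewrite (DS mL) bformBm lerBlDr lerDl.
(* The subtracted term is the quadratic form of D m at v C (D m)^-1. *)
have := pivot_ge (ltnW mL) (v *m C m.+1 *m invmx (D m)).
have -> : bform (D m) (v *m C m.+1 *m invmx (D m)) (v *m C m.+1 *m invmx (D m)) =
          bform (C m.+1 *m invmx (D m) *m (C m.+1)^T) v v.
  by rewrite /bform mulmxKV // !trmx_mul trmx_inv Ds !mulmxA.
by apply: le_trans; rewrite mulr_ge0 ?sqnorm_ge0 // ltW.
Qed.

End Pivots.

(** Here D and E are the pivots of the forward and of the backward recursion.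
    The lower bound evaluates the energy at the vector glued from the forward
    and the backward substitutions that start at v in block k; the upper bound
    uses that neither family of pivots exceeds the diagonal blocks. *)
Lemma twisted_pivot_bounds a u L B C D E k : 0 < a ->
  (forall i, (i <= L)%N -> (B i)^T = B i) -> coercive a B C L ->
  (forall v, bform (B k) v v <= u * sqnorm v) ->
  D 0%N = B 0%N ->
  (forall i, (i < L)%N ->
     D i.+1 = B i.+1 - C i.+1 *m invmx (D i) *m (C i.+1)^T) ->
  E 0%N = rev_diag L B 0 ->
  (forall i, (i < L)%N -> E i.+1 = rev_diag L B i.+1 -
     rev_sub L C i.+1 *m invmx (E i) *m (rev_sub L C i.+1)^T) ->
  (k <= L)%N ->
  let S := D k + E (L - k)%N - B k in
  S^T = S /\ forall v, a * sqnorm v <= bform S v v <= u * sqnorm v.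
Proof.
move=> a0 Bs BC Bu D0 DS E0 ES kL S.
have kL' := leq_subr k L.
have Bs' i : (i <= L)%N -> (rev_diag L B i)^T = rev_diag L B i.
  by move=> iL; apply: Bs; rewrite leq_subr.
have BC' := coercive_rev BC.
have [Ds HD] := pivot_energy a0 Bs BC D0 DS kL.
have [Es HE] := pivot_energy a0 Bs' BC' E0 ES kL'.
split; first by rewrite /S linearB linearD /= Ds Es Bs.
move=> v; rewrite /S bformBm bformDm; apply/andP; split; last first.
  apply: le_trans (Bu v); rewrite lerBlDr lerD //.
    exact: (pivot_le a0 Bs BC D0 DS kL).
  by have := pivot_le a0 Bs' BC' E0 ES kL' v; rewrite /rev_diag subKn.
have [x xk xE] := HD v; have [y yk yE] := HE v.
pose z i := if (i <= k)%N then x i else y (L - i)%N.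
have zk : z k = v by rewrite /z leqnn.
have := @coercive_block _ _ _ _ _ z (ltW a0) BC kL.
rewrite zk (energy_split _ _ _ kL) zk.
rewrite (@eq_energy _ _ k z x) => [|i ik]; last by rewrite /z ik.
rewrite (@eq_energy _ _ (L - k) _ y) ?xE ?yE // => i ik.
have iL : (i <= L)%N by lia.
rewrite /z subKn //; case: ifP => // ik'.
by rewrite (_ : i = L - k)%N ?yk ?subKn //; lia.
Qed.

End Energy.

(** * From the block matrix to its quadratic form *)

Section BlockTridiagonal.
Variables (R : realType) (n : nat).
Implicit Types (b c : nat -> 'M[R]_n) (x : nat -> 'rV[R]_n).

Lemma sqnorm_mxrow N x :
  sqnorm (\mxrow_(i < N) x i) = \sum_(i < N) sqnorm (x i).
Proof. by rewrite /sqnorm tr_mxrow mul_mxrow_mxcol summxE. Qed.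

Lemma bform_mxblock N (M : 'I_N -> 'I_N -> 'M[R]_n) x :
  bform (\mxblock_(i < N, j < N) M i j) (\mxrow_(i < N) x i) (\mxrow_(i < N) x i)
  = \sum_(i < N) \sum_(j < N) bform (M i j) (x i) (x j).
Proof.
rewrite /bform mul_mxrow_mxblock tr_mxrow mul_mxrow_mxcol summxE exchange_big.
apply: eq_bigr => j _; rewrite mulmx_suml summxE.
by apply: eq_bigr.
Qed.

(** The induction adds the last row and the last column, which meet the band in
    three places. *)
Lemma big_tridiag (F : nat -> nat -> R) m :
  (forall i j, (i.+1 < j)%N || (j.+1 < i)%N -> F i j = 0) ->
  \sum_(i < m.+1) \sum_(j < m.+1) F i j =
  \sum_(i < m.+1) F i i + \sum_(i < m) (F i i.+1 + F i.+1 i).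
Proof.
move=> F0; elim: m => [|m IH]; first by rewrite !big_ord1 big_ord0 addr0.
rewrite big_ord_recr /=.
under eq_bigr do rewrite big_ord_recr /=.
rewrite big_split /= IH.
rewrite [X in _ + X + _]big_ord_recr /= [X in _ + (X + _) + _]big1 => [|i _]; last first.
  by rewrite F0 // !ltnS ltn_ord.
rewrite [X in _ + _ + X]big_ord_recr /= [X in _ + _ + (X + _)]big_ord_recr /=.
rewrite [X in _ + _ + (X + _ + _)]big1 => [|i _]; last first.
  by rewrite F0 // !ltnS ltn_ord orbT.
rewrite [in RHS]big_ord_recr /= [X in _ = _ + X]big_ord_recr /=; ring.
Qed.

Lemma bform_block_tridiag b c L x :
  bform (block_tridiag L.+1 b c) (\mxrow_(i < L.+1) x i) (\mxrow_(i < L.+1) x i)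
  = energy (fun i => b i.+1) (fun i => c i.+1) L x.
Proof.
rewrite bform_mxblock.
pose F i j := bform (if i == j then b i.+1 else if i == j.+1 then c i.+1
  else if j == i.+1 then (c j.+1)^T else 0) (x i) (x j).
rewrite -[LHS]/(\sum_(i < L.+1) \sum_(j < L.+1) F i j) big_tridiag => [|i j ij].
  rewrite /energy mulr_sumr; congr (_ + _); apply: eq_bigr => i _.
    by rewrite /F eqxx.
  have e1 : (i == i.+1 :> nat) = false by lia.
  have e2 : (i == i.+2 :> nat) = false by lia.
  have e3 : (i.+1 == i :> nat) = false by lia.
  by rewrite /F e1 e2 e3 !eqxx bform_tr; ring.
rewrite /F !ifF; first by rewrite /bform mulmx0 mul0mx mxE.
all: lia.
Qed.

Lemma block_tridiag_sym_diag b c N : (block_tridiag N b c)^T = block_tridiag N b c ->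
  forall i, (i < N)%N -> (b i.+1)^T = b i.+1.
Proof.
rewrite /block_tridiag tr_mxblock => /eq_mxblockP H i iN.
by have := H (Ordinal iN) (Ordinal iN); rewrite !eqxx.
Qed.

End BlockTridiagonal.

Theorem mainTheorem10 (R : realType) (N n : nat) (N_gt0 : (0 < N)%N)
    (n_gt0 : (0 < n)%N) (b c : nat -> 'M[R]_n) (A : 'M[R]_(\sum_(k < N) n))
    (A_tridiag : A = block_tridiag N b c) (A_sym : A^T = A)
    (alphaL alphaU : R)
    (A_spec : [/\ 0 < alphaL, alphaL <= lambda_min A,
                  lambda_min A <= lambda_max A & lambda_max A <= alphaU])
    (df db : nat -> 'M[R]_n)
    (df_1 : df 1%N = b 1%N)
    (df_rec : forall k : nat, (2 <= k <= N)%N ->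
       df k = b k - c k *m invmx (df k.-1) *m (c k)^T)
    (db_N : db N = b N)
    (db_rec : forall k : nat, (1 <= k <= N.-1)%N ->
       db k = b k - (c k.+1)^T *m invmx (db k.+1) *m c k.+1) :
  (* the inverses in both recursions exist *)
  (forall k : nat, (1 <= k <= N.-1)%N -> df k \in unitmx) /\
  (forall k : nat, (2 <= k <= N)%N -> db k \in unitmx) /\
  (forall k : nat, (1 <= k <= N)%N ->
     (df k + db k - b k)^T = df k + db k - b k /\
     [/\ 0 < alphaL,
         alphaL <= lambda_min (df k + db k - b k),
         lambda_min (df k + db k - b k) <= lambda_max (df k + db k - b k) &
         lambda_max (df k + db k - b k) <= alphaU]).
Proof.
have [aL aLmin _ maxaU] := A_spec.
case: N N_gt0 A A_tridiag A_sym A_spec df_rec db_N db_rec aLmin maxaU => // L _.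
move=> A A_tridiag A_sym _ df_rec db_N db_rec aLmin maxaU.
(* Blocks are renumbered from 0; E follows the backward recursion from its start. *)
pose B i := b i.+1; pose C i := c i.+1.
pose D i := df i.+1; pose E i := db (L.+1 - i)%N.
have AE (x : nat -> 'rV[R]_n) : alphaL * \sum_(i < L.+1) sqnorm (x i) <= energy B C L x
            <= alphaU * \sum_(i < L.+1) sqnorm (x i).
  have /andP[lA uA] := lambda_min_max_bounds A_sym (\mxrow_(i < L.+1) x i).
  rewrite -bform_block_tridiag -A_tridiag -sqnorm_mxrow.
  apply/andP; split.
    by apply: le_trans lA; rewrite ler_wpM2r ?sqnorm_ge0.
  by apply: le_trans uA _; rewrite ler_wpM2r ?sqnorm_ge0.
have BC : coercive alphaL B C L by move=> x; have /andP[] := AE x.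
have Bs i : (i <= L)%N -> (B i)^T = B i.
  by move=> iL; apply: (@block_tridiag_sym_diag _ _ b c L.+1) => //;
     rewrite -A_tridiag.
have Bu k : (k <= L)%N -> forall v, bform (B k) v v <= alphaU * sqnorm v.
  by move=> kL v; apply: (@diag_block_le _ _ _ B C L) => // x; case/andP: (AE x).
have D0 : D 0%N = B 0%N by [].
have DS i : (i < L)%N -> D i.+1 = B i.+1 - C i.+1 *m invmx (D i) *m (C i.+1)^T.
  by move=> iL; rewrite /D df_rec //; lia.
have E0 : E 0%N = rev_diag L B 0 by rewrite /E /rev_diag !subn0.
have ES i : (i < L)%N -> E i.+1 = rev_diag L B i.+1 -
     rev_sub L C i.+1 *m invmx (E i) *m (rev_sub L C i.+1)^T.
  move=> iL; rewrite /E /rev_diag /rev_sub /B /C trmxK subSS.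
  rewrite db_rec; last lia.
  have e1 : (L.+1 - i = (L - i).+1)%N by lia.
  have e2 : (L - i = (L - i.+1).+1)%N by lia.
  by rewrite e1 e2.
have Bs' i : (i <= L)%N -> (rev_diag L B i)^T = rev_diag L B i.
  by move=> iL; apply: Bs; rewrite leq_subr.
split; last split.
- case=> // k kL; apply: (pivot_unitmx aL Bs BC D0 DS); lia.
- move=> k kL; have -> : db k = E (L.+1 - k)%N by rewrite /E subKn //; lia.
  by apply: (pivot_unitmx aL Bs' (coercive_rev BC) E0 ES); lia.
- case=> // k kL; have kL' : (k <= L)%N by lia.
  have -> : db k.+1 = E (L - k)%N by rewrite /E; congr db; lia.
  have [Ss Sb] := twisted_pivot_bounds aL Bs BC (Bu k kL') D0 DS E0 ES kL'.
  split; first exact: Ss.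
  by have [] := bform_bounds_lambda n_gt0 Ss Sb; split.
Qed.
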